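(* Let $X=\{X(t):t\in\mathbb{R}\}$ be a stationary shot noise process $X(t)=\sum_i\beta_i g(t-\tau_i)$, $I\subset\mathbb{R}$ a bounded interval, $u\in\mathbb{R}$, and $N_u=\#\{t\in I:X(t)=u\}$. Assume that: (1) the sample paths of $X$ are $C^k(I)$ for some $k\ge1$; (2) for this $k$ and some integer $m\ge1$, $\mathbf{E}(|X^{(k)}|_\infty^m)<\infty$; (3) there is a constant $C>0$ such that the density of $X(t)$ is bounded by $C$ uniformly in $t\in I$ and on a neighborhood of $u$. Then $\mathbf{E}(N_u^p)<\infty$ for every $p=1,2,\dots$ with $$p<\frac{m}{m+1}(k-1).$$
   Context: In the shot noise process, $(\beta_i)$ (the impulses) is a sequence of i.i.d. integrable random variables, $(\tau_i)$ is a Poisson field on $\mathbb{R}$ with constant intensity $\lambda>0$, independent of $(\beta_i)$, and $g:\mathbb{R}\to\mathbb{R}$ (the kernel) belongs to $L^1(\mathbb{R})$; this ensures a.s. convergence of the series. $|X^{(k)}|_\infty=\sup_{t\in I}|X^{(k)}(t)|$. *)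

(* Defs.v *)
From HB Require Import structures.
From mathcomp Require Export all_boot all_order all_algebra finmap.
From mathcomp Require Export all_classical all_reals all_analysis measurable_realfun.

Set Implicit Arguments.
Unset Strict Implicit.
Unset Printing Implicit Defensive.

Import Order.TTheory GRing.Theory Num.Theory.
Import numFieldNormedType.Exports.

Local Open Scope classical_set_scope.
Local Open Scope ring_scope.

Section Independence.
Context {d d' : measure_display} {Omega : measurableType d}
  {S : measurableType d'} {R : realType}.
Implicit Type P : probability Omega R.

Definition mutually_independent {J : choiceType} P (Y : J -> Omega -> S) :
    Prop :=
  forall (F : {fset J}) (A : J -> set S), (forall j, measurable (A j)) ->
    P (\bigcap_(j in [set` F]) (Y j @^-1` A j)) =
    (\prod_(j <- F) P (Y j @^-1` A j))%E.

Definition sigma_of {J : Type} (Y : J -> Omega -> S) : set (set Omega) :=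
  <<s \bigcup_j preimage_set_system setT (Y j) measurable >>.

End Independence.

Section ShotNoise.
Context {d : measure_display} {Omega : measurableType d} {R : realType}.
Implicit Type P : probability Omega R.

Definition independent_families {J K : Type} P
    (Y : J -> Omega -> R) (Z : K -> Omega -> R) : Prop :=
  forall A B : set Omega, sigma_of Y A -> sigma_of Z B ->
    P (A `&` B) = (P A * P B)%E.

Definition iid P (Y : nat -> {RV P >-> R}) : Prop :=
  mutually_independent P (fun i => Y i : Omega -> R) /\
  (forall i A, measurable A ->
     distribution P (Y i) A = distribution P (Y 0%N) A).

Definition point_count (tau : nat -> Omega -> R) (A : set R) (w : Omega) :
    \bar R :=
  counting [set i | A (tau i w)].

(* The second argument of poisson_prob is a dummy; a rate 0 gives the Dirac
   mass at 0. *)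
Definition poisson_field P (lambda : R) (tau : nat -> {RV P >-> R}) : Prop :=
  (forall A : set R, measurable A -> (lebesgue_measure A < +oo)%E ->
     forall n : nat,
       P [set w | point_count tau A w = n%:R%:E] =
       poisson_prob (lambda * fine (lebesgue_measure A)) 0 [set n]) /\
  (forall (n : nat) (A : 'I_n -> set R), (forall i, measurable (A i)) ->
     trivIset setT A ->
     mutually_independent P (fun i => point_count tau (A i))).

(* The series converges only almost surely for each fixed t, so X may be any
   version of its sum. *)
Definition shot_noise P (lambda : R) (beta tau : nat -> {RV P >-> R})
    (g : R -> R) (X : R -> {RV P >-> R}) : Prop :=
  [/\ 0 < lambda,
      iid beta /\ (forall i, P.-integrable setT (EFin \o beta i)),
      poisson_field lambda tau /\ independent_families P beta tau,
      (lebesgue_measure : measure _ R).-integrable setT (EFin \o g) &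
      forall t : R, {ae P, forall w,
        (\sum_(0 <= i < n) beta i w * g (t - tau i w)) @[n --> \oo] --> X t w}].

Definition stationary P (X : R -> {RV P >-> R}) : Prop :=
  forall (n : nat) (t : n.-tuple R) (h : R) (B : set (n.-tuple R)),
    measurable B ->
    P [set w | B [tuple X (tnth t i + h) w | i < n]] =
    P [set w | B [tuple X (tnth t i) w | i < n]].

Definition is_density P (Y : {RV P >-> R}) (f : R -> R) : Prop :=
  [/\ measurable_fun setT f, forall x, 0 <= f x &
      forall A : set R, measurable A ->
        distribution P Y A = (\int[lebesgue_measure]_(x in A) (f x)%:E)%E].

Definition level_count (X : R -> Omega -> R) (I : set R) (u : R) (w : Omega) :
    \bar R :=
  counting [set t | I t /\ X t w = u].

End ShotNoise.

(* Derivatives of a function on an interval I, relative to I: one-sided at an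
   endpoint that belongs to I. *)
Section DerivativesOn.
Context {R : realType}.
Implicit Types (I : set R) (f : R -> R).

Definition diff_quotient f (x y : R) : R := (f y - f x) / (y - x).

Definition derivable_on I f : Prop :=
  forall x, I x -> cvg (diff_quotient f x y @[y --> within I x^']).

Definition derive_on I f : R -> R :=
  fun x => lim (diff_quotient f x y @[y --> within I x^']).

Definition deriven_on I (n : nat) f : R -> R := iter n (derive_on I) f.

Definition Ck_on I (k : nat) f : Prop :=
  (forall j, (j < k)%N -> derivable_on I (deriven_on I j f)) /\
  {within I, continuous (deriven_on I k f)}.

Definition sup_norm_on I f : \bar R := ereal_sup [set `|f t|%:E | t in I].

End DerivativesOn.

(* Main.v *)
Require Import Defs.
From mathcomp Require Import ring lra.

(** Cut [I] into [n] cells of length [h = L / n].  If some cell holds [k]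
solutions of [X(t) = u], then repeated use of Rolle's theorem puts a zero of
[X'], ..., [X^(k-1)] in that cell, and climbing back up with the mean value
theorem gives [|X - u| <= M h^k] on the whole cell, where [M] is the supremum
of [|X^(k)|] ([dist_le_of_solutions]).  Hence, once one point [t_j] is fixed in
each cell, [N_u >= n k] forces either [M > a], or
[|X(t_j) - u| <= a h^k] for some [j] ([level_count_le_cells]).  Markov's
inequality bounds the probability of the first event by [E(M^m) / a^m], and the
bounded density bounds that of the second by [2 C n a h^k], which is of order
[a n^(1-k)] ([level_count_tail]).  The two bounds balance at
[a = n^((k-1)/(m+1))] and give [P(N_u >= n k) = O(n^-q)] with
[q = m (k-1) / (m+1)].  So [E(N_u^p)] is finite as soon as [p < q].

The tail is summed along [n = K 2^i] only: then the sum defining the moment is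
a geometric series of ratio [2^(p-q) < 1]
([moment_finite_of_dyadic_tails]).  The integer [K] is chosen so large that
[a h^k] stays below the radius of the neighborhood of [u] on which the densities
are bounded, at every scale at once.

The number of solutions and the supremum of [|X^(k)|] need not be measurable,
and the integral of a nonnegative function is then a lower integral: the
supremum of the integrals of the simple functions below it.  This costs nothing,
because the lower integral is monotone ([ge0_le_lower_integral]): the
count is dominated by a measurable series of indicators, and for the
supremum only the events [M > a] matter.  On the set of smooth paths these
coincide with measurable events, since the derivatives are limits
of difference quotients along sequences and their supremum can be
taken over a countable dense set ([sup_norm_deriven_on_tail]). *)

Set Implicit Arguments.
Unset Strict Implicit.
Unset Printing Implicit Defensive.

Import Order.TTheory GRing.Theory Num.Theory.
Import numFieldNormedType.Exports.

Local Open Scope classical_set_scope.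
Local Open Scope ring_scope.

(** * Many solutions on a short interval *)

Section Calculus.
Context {R : realType}.
Implicit Types (I : set R) (f : R -> R).

Lemma derivable_on_continuous I f :
  derivable_on I f -> {within I, continuous f}.
Proof.
move=> df; apply/subspace_continuousP => x Ix.
have := df x Ix; set l := lim _ => fl.
apply/cvgrPdist_lt => e e0.
have /cvgrPdist_lt /(_ 1 ltr01) near_dq := fl.
have l1 : 0 < `|l| + 1 by rewrite ltr_wpDl.
have near_x : \forall y \near x, `|y - x| < e / (`|l| + 1).
  apply/nbhs_ballP; exists (e / (`|l| + 1)) => /=; first by rewrite divr_gt0.
  by move=> y; rewrite /ball /= distrC.
rewrite near_withinE; near=> y => Iy.
have [->|yx] := eqVneq y x; first by rewrite subrr normr0.
have yx0 : y - x != 0 by rewrite subr_eq0.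
have dqy : `|l - diff_quotient f x y| < 1.
  have yx' : y != x by [].
  move: yx' Iy; near: y; exact: near_dq.
have -> : f x - f y = - (diff_quotient f x y * (y - x)).
  by rewrite /diff_quotient divfK // opprB.
rewrite normrN normrM.
have dq_le : `|diff_quotient f x y| <= `|l| + 1.
  rewrite -[diff_quotient f x y](subrK l) addrC.
  rewrite (le_trans (ler_normD _ _)) // lerD2l distrC; exact: ltW.
apply: (@le_lt_trans _ _ ((`|l| + 1) * `|y - x|)).
  by rewrite ler_wpM2r.
rewrite mulrC -ltr_pdivlMr //.
by near: y.
Unshelve. all: by end_near. Qed.

(** At an interior point the relative derivative is the ordinary one; this
is what makes the mean value theorem below available for [derive_on]. *)
Lemma derive_on_interior I f c : I c -> nbhs c I -> derivable_on I f ->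
  is_derive c 1 f (derive_on I f c).
Proof.
move=> Ic nI /(_ c Ic) fl.
have shiftI : h + c @[h --> 0^'] --> within I c^'.
  move=> Q; rewrite /within /= => nQ.
  have {nI nQ} : nbhs c [set y | y != c -> Q y].
    move: nQ; rewrite /dnbhs /within => nQ.
    by apply: filterS2 nI nQ => y Iy Qy yc; exact: Qy.
  case/nbhs_ballP => e /= e0 eQ; apply/nbhs_ballP; exists e => //= h.
  rewrite /ball /= sub0r normrN => he h0; apply: eQ => /=.
    by rewrite /ball /= opprD addrCA subrr addr0 normrN.
  by rewrite -subr_eq0 addrK.
have cvgh : h^-1 *: ((f \o shift c) (h *: (1:R)) - f c) @[h --> 0^'] -->
    derive_on I f c.
  have -> : (fun h => h^-1 *: ((f \o shift c) (h *: (1:R)) - f c)) =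
      diff_quotient f c \o (fun h => h + c).
    apply/funext => h /=; rewrite /diff_quotient addrK [h *: 1]mulr1.
    by rewrite [_ *: _]mulrC.
  exact: cvg_comp shiftI fl.
have dfc : derivable f c 1 by apply/cvg_ex; exists (derive_on I f c).
apply: DeriveDef => //.
exact: cvg_lim.
Qed.

Lemma MVT_on I f x y : is_interval I -> I x -> I y -> x < y ->
  derivable_on I f ->
  exists2 c, x < c < y & f y - f x = derive_on I f c * (y - x).
Proof.
move=> itvI Ix Iy xy df.
have sub : `[x, y] `<=` I.
  by move=> z /=; rewrite in_itv /=; exact: itvI Ix Iy _.
have [||c cxy ->] := @MVT R f (derive_on I f) x y xy.
- move=> c cxy; apply: derive_on_interior => //.
    by apply: sub; apply: subset_itv_oo_cc.
  have : nbhs c `]x, y[%classic by apply: open_nbhs_nbhs; split.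
  by apply: filterS => z zxy; apply: sub; apply: subset_itv_oo_cc.
- exact: continuous_subspaceW sub (derivable_on_continuous df).
- by exists c => //; move: cxy; rewrite in_itv.
Qed.

Definition solutions (J : set R) f (v : R) (s : seq R) : Prop :=
  forall t, t \in s -> J t /\ f t = v.

(** One step of the descent: consecutive solutions of [f = v] enclose a zero of
the derivative, and these zeros are again listed in increasing order, so the
step can be repeated. *)
Lemma Rolle_seq I J f v s : is_interval I -> is_interval J -> J `<=` I ->
  derivable_on I f -> sorted <%R s -> solutions J f v s ->
  exists2 s', sorted <%R s' /\ size s' = (size s).-1 &
    solutions J (derive_on I f) 0 s'.
Proof.
move=> itvI itvJ JI df.
case: s => [_ _|x s]; first by exists [::].
rewrite /=.
(* The new list must start to the right of [x] for the induction to keep it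
   sorted. *)
suff: path <%R x s -> solutions J f v (x :: s) ->
    exists2 s', path <%R x s' /\ size s' = size s &
      solutions J (derive_on I f) 0 s'.
  move=> H xs sol; have [s' [xs' ss'] sol'] := H xs sol.
  by exists s' => //; split => //; exact: path_sorted xs'.
elim: s x => [|y s IH] x /=; first by exists [::].
move=> /andP[xy ys] sol.
have [|s' [ys' ss'] sol'] := IH y ys.
  by move=> t ts; apply: sol; rewrite inE ts orbT.
have [Jx fx] := sol x (mem_head _ _).
have [Jy fy] : J y /\ f y = v by apply: sol; rewrite !inE eqxx orbT.
have [c /andP[xc cy] fc] := MVT_on itvI (JI _ Jx) (JI _ Jy) xy df.
exists (c :: s') => /=.
  split; last by rewrite ss'.
  rewrite xc; case: s' ys' {ss' sol'} => //= z s' /andP[yz ->].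
  by rewrite (lt_trans cy yz).
move=> t; rewrite inE => /orP[/eqP ->|]; last exact: sol'.
split; first by apply: itvJ Jx Jy _ _; rewrite !ltW.
move: fc; rewrite fx fy subrr => /esym/eqP.
by rewrite mulf_eq0 [_ - _ == 0]subr_eq0 (gt_eqF xy) orbF => /eqP.
Qed.

Lemma dist_le_derive I J f z t B h : is_interval I -> is_interval J ->
  J `<=` I -> derivable_on I f -> J z -> J t -> `|t - z| <= h ->
  (forall c, J c -> `|derive_on I f c| <= B) ->
  `|f t - f z| <= B * h.
Proof.
move=> itvI itvJ JI df.
wlog zt : z t / z <= t.
  move=> H Jz Jt tz bB; have [zt|/ltW zt] := leP z t; first exact: H.
  by rewrite distrC; apply: H => //; rewrite distrC.
move=> Jz Jt tz bB; move: zt; rewrite le_eqVlt => /orP[/eqP <-|zt].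
  by rewrite subrr normr0 mulr_ge0 // (le_trans _ (bB _ Jz), le_trans _ tz).
have [c /andP[zc ct] ->] := MVT_on itvI (JI _ Jz) (JI _ Jt) zt df.
rewrite normrM ler_pM // bB //.
by apply: itvJ Jz Jt _ _; rewrite !ltW.
Qed.

Lemma deriven_onS I n f : deriven_on I n (derive_on I f) = deriven_on I n.+1 f.
Proof. by rewrite /deriven_on iterSr. Qed.

Lemma Ck_on_derivable I k f : Ck_on I k.+1 f -> derivable_on I f.
Proof. by move=> [/(_ 0%N isT)]. Qed.

Lemma Ck_on_derive I k f : Ck_on I k.+1 f -> Ck_on I k (derive_on I f).
Proof.
move=> [df cf]; split; last by rewrite deriven_onS.
by move=> j jk; rewrite deriven_onS; apply: df.
Qed.

(** Induction on [k]: by [Rolle_seq], [f'] vanishes at [k] points of [J] when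
[f] takes the value [v] at [k+1] points, so [|f'| <= a h^k] on [J]; integrating
from a solution of [f = v] gains one more factor [h].  The level [v] is
arbitrary at the first step and [0] at all later ones. *)
Lemma dist_le_of_solutions I J k f v a h s t : is_interval I ->
  is_interval J -> J `<=` I -> (forall x y, J x -> J y -> `|x - y| <= h) ->
  Ck_on I k.+1 f -> (forall x, J x -> `|deriven_on I k.+1 f x| <= a) ->
  sorted <%R s -> size s = k.+1 -> solutions J f v s ->
  J t -> `|f t - v| <= a * h ^+ k.+1.
Proof.
move=> itvI itvJ JI Jh.
elim: k f v s t => [|k IH] f v s t Cf bf ss sk sol Jt;
  have df := Ck_on_derivable Cf;
  have [s' [ss' sk'] sol'] := Rolle_seq itvI itvJ JI df ss sol;
  case: s sk {ss} sol sk' => // z s [sk] /(_ z (mem_head _ _)) [Jz <-] /= sk'.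
  by rewrite expr1; apply: dist_le_derive JI df Jz Jt (Jh _ _ Jt Jz) bf.
rewrite exprSr mulrA; apply: dist_le_derive JI df Jz Jt (Jh _ _ Jt Jz) _ => //.
move=> c Jc; rewrite -[derive_on I f c]subr0.
apply: IH ss' _ sol' Jc; first exact: Ck_on_derive.
  by move=> x Jx; rewrite deriven_onS; exact: bf.
by rewrite sk' sk.
Qed.

End Calculus.

(** * Counting solutions cell by cell *)

Section Counting.
Context {R : realType}.

Lemma counting_le (A : set R) (n : nat) :
  (forall s : seq R, uniq s -> (forall t, t \in s -> A t) -> (size s <= n)%N) ->
  (counting A <= n%:R%:E :> \bar R)%E.
Proof.
move=> An; rewrite /counting; case: asboolP => [finA|infA].
  rewrite lee_fin ler_nat; apply: An => [|t]; first exact: fset_uniq.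
  by rewrite in_fset_set // inE.
have [B BA nB] := infinite_set_fset n.+1 infA.
have := An _ (fset_uniq B) (fun t tB => BA t tB).
by move=> /(leq_trans nB); rewrite ltnn.
Qed.

Lemma size_le_sum_count (T : eqType) (n : nat) (c : 'I_n -> pred T)
    (s : seq T) : (forall t, t \in s -> exists j, c j t) ->
  (size s <= \sum_(j < n) count (c j) s)%N.
Proof.
elim: s => [|x s IH] // cov.
have [j cjx] := cov x (mem_head _ _).
rewrite big_split /= -addn1 addnC leq_add //.
  by rewrite (bigD1 j) //= cjx.
by apply: IH => t ts; apply: cov; rewrite inE ts orbT.
Qed.

Lemma counting_le_cells (A : set R) (n k : nat) (J : 'I_n -> set R) :
  A `<=` \bigcup_j J j ->
  (forall j s, sorted <%R s -> (forall t, t \in s -> J j t /\ A t) ->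
     size s <> k.+1) ->
  (counting A <= (n * k)%:R%:E :> \bar R)%E.
Proof.
move=> cov fewJ; apply: counting_le => s us sA.
apply: (leq_trans (size_le_sum_count (c := fun j t => t \in J j) _)).
  by move=> t /sA /cov [j _ Jjt]; exists j; rewrite inE.
rewrite -[n in (n * k)%N]card_ord -sum_nat_const; apply: leq_sum => j _.
rewrite leqNgt; apply/negP => many.
apply: (fewJ j (take k.+1 (sort <=%R [seq t <- s | t \in J j]))).
- by apply: take_sorted; rewrite sort_lt_sorted filter_uniq.
- move=> t /mem_take; rewrite mem_sort mem_filter => /andP[/set_mem Jt /sA].
  by split.
- by rewrite size_takel // size_sort size_filter.
Qed.

(** If [k+1] solutions fell in one cell, [dist_le_of_solutions] would put the value
at the sampling point [t j] within [a h^(k+1)] of the level. *)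
Lemma level_count_le_cells (I : set R) (k : nat) (f : R -> R) (u a h : R)
    (n : nat) (J : 'I_n -> set R) (t : 'I_n -> R) :
  is_interval I -> Ck_on I k.+1 f ->
  (forall x, I x -> `|deriven_on I k.+1 f x| <= a) ->
  (forall j, is_interval (J j)) -> (forall j, J j `<=` I) ->
  I `<=` \bigcup_j J j ->
  (forall j x y, J j x -> J j y -> `|x - y| <= h) ->
  (forall j, J j !=set0 -> J j (t j)) ->
  (forall j, a * h ^+ k.+1 < `|f (t j) - u|) ->
  (counting [set x | I x /\ f x = u] <= (n * k)%:R%:E :> \bar R)%E.
Proof.
move=> itvI Cf bf itvJ JI cov Jh Jt far.
apply: (counting_le_cells (J := J)) => [x [Ix _]|j s ss sol sk]; first exact: cov.
have solJ : solutions (J j) f u s by move=> x /sol[Jx [_ fx]].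
have Jtj : J j (t j).
  case: s sk {ss sol} solJ => // x s _ /(_ x (mem_head _ _)) [Jx _].
  by apply: Jt; exists x.
move: (far j); apply/negP; rewrite -leNgt.
apply: (dist_le_of_solutions itvI (itvJ j) (JI j) (Jh j) Cf _ ss sk solJ Jtj).
by move=> x /JI; exact: bf.
Qed.

(** The cells are half-open so that they cover [I] without any special case for
a last cell; a cell may be empty. *)
Definition grid_cell (I : set R) (a h : R) (j : nat) : set R :=
  I `&` [set x | a + h * j%:R <= x < a + h * j.+1%:R].

Lemma grid_cell_interval I a h j : is_interval I ->
  is_interval (grid_cell I a h j).
Proof.
move=> itvI x y [Ix /andP[ax _]] [Iy /andP[_ ya]] z /andP[xz zy].
split; first by apply: itvI Ix Iy _ _; rewrite xz.
by rewrite /= (le_trans ax) //= (le_lt_trans zy).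
Qed.

Lemma grid_cell_diam I a h j x y :
  grid_cell I a h j x -> grid_cell I a h j y -> `|x - y| <= h.
Proof.
move=> [_ /andP[ax xa]] [_ /andP[ay ya]].
move: xa ya; rewrite -natr1 mulrDr mulr1 => xa ya.
rewrite ler_norml; apply/andP; split; lra.
Qed.

Lemma grid_cell_cover I a h (n : nat) : 0 < h ->
  (forall x, I x -> a <= x < a + h * n%:R) ->
  I `<=` \bigcup_(j in [set: 'I_n]) grid_cell I a h j.
Proof.
move=> h0 Iab x Ix; have /andP[ax xb] := Iab x Ix.
have /truncn_itv/andP[jle ltj] : 0 <= (x - a) / h.
  by rewrite divr_ge0 ?subr_ge0 // ltW.
have jn : (Num.truncn ((x - a) / h) < n)%N.
  rewrite -(ltr_nat R) (le_lt_trans jle) // ltr_pdivrMr // mulrC.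
  by rewrite ltrBlDl.
exists (Ordinal jn) => //; split => //=.
by rewrite -lerBrDl -ltrBlDl mulrC -ler_pdivlMr // jle mulrC -ltr_pdivrMr.
Qed.

End Counting.

(** * Lower integrals *)

Section LowerIntegral.
Local Open Scope ereal_scope.
Context {R : realType} {d : measure_display} {T : measurableType d}.
Variable mu : {measure set T -> \bar R}.

(** For nonnegative functions the integral is a supremum over simple functions
from below, hence monotone without any measurability. *)
Lemma ge0_le_lower_integral (f g : T -> \bar R) :
  (forall x, 0 <= f x) -> (forall x, f x <= g x) ->
  \int[mu]_x f x <= \int[mu]_x g x.
Proof.
move=> f0 fg; have g0 x : 0 <= g x by exact: le_trans (fg x).
rewrite !ge0_integralTE //; apply: le_ereal_sup => _ [h hf <-].
by exists h => // x; exact: le_trans (fg x).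
Qed.

Lemma lee_expe (x y : \bar R) (n : nat) : 0 <= x -> x <= y -> x ^+ n <= y ^+ n.
Proof.
move=> x0 xy; elim: n => [|n IH]; first by rewrite !expe0.
by rewrite !expeS lee_pmul // expe_ge0.
Qed.

Lemma integral_scaled_indic (c : R) (E : set T) : measurable E -> (0 <= c)%R ->
  \int[mu]_x (c * \1_E x)%:E = c%:E * mu E.
Proof.
move=> mE c0; under eq_integral do rewrite EFinM.
rewrite ge0_integralZl_EFin //; first by rewrite integral_indic // setIT.
by apply/measurable_EFinP; exact: measurable_indic.
Qed.

(** Markov's inequality in the form that survives for a nonmeasurable [f]: only
a measurable subset of the event [a <= f] can be estimated. *)
Lemma markov_lower (f : T -> \bar R) (a : R) (m : nat) (E : set T) :
  measurable E -> (0 <= a)%R -> (forall x, 0 <= f x) ->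
  (forall x, E x -> a%:E <= f x) ->
  (a ^+ m)%:E * mu E <= \int[mu]_x (f x ^+ m).
Proof.
move=> mE a0 f0 Ef; rewrite -integral_scaled_indic ?exprn_ge0 //.
apply: ge0_le_lower_integral => x.
  by rewrite lee_fin mulr_ge0 ?exprn_ge0.
rewrite indicE; case: (boolP (x \in E)) => [/set_mem xE|_].
  by rewrite mulr1 EFin_expe lee_expe // ?lee_fin // Ef.
by rewrite mulr0 expe_ge0.
Qed.

End LowerIntegral.

(** * Measurability of the path derivatives *)

Section DenseSequences.
Context {R : realType}.
Implicit Types I : set R.

Lemma cvg_within_punctured I x y : is_interval I -> I x -> I y -> x != y ->
  exists2 v : nat -> R, (forall n, I (v n)) & v n @[n --> \oo] --> within I x^'.
Proof.
move=> itvI Ix Iy xy; pose v n := x + (y - x) * harmonic n.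
have vI n : I (v n).
  have [h0 h1] : 0 < harmonic n :> R /\ harmonic n <= 1 :> R.
    by rewrite harmonic_gt0 /harmonic invf_le1 ?ler1n.
  have [xley|/ltW ylex] := leP x y; [apply: itvI Ix Iy _ _|apply: itvI Iy Ix _ _];
    rewrite /v; apply/andP; split; nra.
exists v => // Q; rewrite /within /dnbhs /= => nQ.
have cv : v n @[n --> \oo] --> x.
  rewrite -[x in _ --> x]addr0; apply: cvgD; first exact: cvg_cst.
  rewrite -(mulr0 (y - x)); apply: cvgM; first exact: cvg_cst.
  exact: cvg_harmonic.
have nQv : \forall n \near \oo, v n != x -> I (v n) -> Q (v n) := cv _ nQ.
suff : \forall n \near \oo, Q (v n) by [].
apply: filterS nQv => n; apply => //.
rewrite /v -subr_eq0 addrAC subrr add0r mulf_neq0 //; first by rewrite subr_eq0 eq_sym.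
by rewrite gt_eqF ?harmonic_gt0.
Qed.

(** The rational points of [I], padded with [c]. *)
Lemma interval_dense_seq I c : is_interval I -> I c ->
  exists2 D : nat -> R, (forall n, I (D n)) &
    forall x y, I x -> I y -> x < y -> exists n, x < D n < y.
Proof.
move=> itvI Ic.
pose D n := if (choice.unpickle n : option rat) is Some q then
  (if `[< I (ratr q) >] then ratr q else c) else c.
exists D => [n|x y Ix Iy xy].
  by rewrite /D; case: choice.unpickle => // q; case: asboolP.
have [q] := rat_in_itvoo xy; rewrite in_itv /= => /andP[xq qy].
exists (choice.pickle q); rewrite /D choice.pickleK ifT ?xq //.
by apply/asboolP; apply: itvI Ix Iy _ _; rewrite !ltW.
Qed.

(** The second point [y] rules out a one-point interval, on which no [D n] needs
to be close to [x]. *)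
Lemma continuous_le_dense I (f : R -> R) (D : nat -> R) a x y :
  is_interval I -> I x -> I y -> x != y ->
  (forall n, I (D n)) ->
  (forall x y, I x -> I y -> x < y -> exists n, x < D n < y) ->
  {within I, continuous f} -> (forall n, f (D n) <= a) -> f x <= a.
Proof.
move=> itvI Ix Iy xy ID dD /subspace_continuousP /(_ x Ix) cf fD.
rewrite leNgt; apply/negP => afx.
have /nbhs_ballP[e /= e0 near_x] : nbhs x [set z | I z -> a < f z].
  by apply: (cf [set z | a < z]); exact: lt_nbhsr.
have [v vI cv] := cvg_within_punctured itvI Ix Iy xy.
have : within I x^' [set z | ball x e z /\ z != x].
  by rewrite /within /dnbhs /=; apply/nbhs_ballP; exists e.
move=> nx; have : \forall n \near \oo, ball x e (v n) /\ v n != x := cv _ nx.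
move=> /filter_ex [n [vn vnx]].
have [k [bk Ik]] : exists k, ball x e (D k) /\ I (D k).
  move: vn; rewrite /ball /= ltr_distlC => /andP[vn1 vn2].
  have [xv|vx] := ltP x (v n).
    have [k /andP[k1 k2]] := dD _ _ Ix (vI n) xv.
    exists k; split => //; rewrite ltr_distlC; apply/andP; split; lra.
  have {}vx : v n < x by rewrite lt_neqAle vnx.
  have [k /andP[k1 k2]] := dD _ _ (vI n) Ix vx.
  exists k; split => //; rewrite ltr_distlC; apply/andP; split; lra.
by move: (near_x _ bk Ik); rewrite ltNge fD.
Qed.
End DenseSequences.

Lemma sup_norm_on_ge (R : realType) (I : set R) (f : R -> R) t :
  I t -> (`|f t|%:E <= sup_norm_on I f)%E.
Proof. by move=> It; apply: ereal_sup_ubound; exists t. Qed.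

Lemma sup_norm_on_ge0 (R : realType) (I : set R) (f : R -> R) t :
  I t -> (0 <= sup_norm_on I f)%E.
Proof. by move=> /(sup_norm_on_ge f); apply: le_trans; rewrite lee_fin. Qed.

Section PathDerivatives.
Context {R : realType} {d : measure_display} {Omega : measurableType d}.
Variables (I : set R) (c c' : R) (Y : R -> Omega -> R) (G : set Omega).
Hypotheses (itvI : is_interval I) (Ic : I c) (Ic' : I c') (cc' : c != c').
Hypothesis mY : forall t, I t -> measurable_fun G (Y t).

(** Each derivative at a fixed point is a limit of difference quotients along a
sequence that is the same for all [w]. *)
Lemma measurable_deriven_on (j : nat) :
  (forall w, G w -> forall i, (i < j)%N ->
     derivable_on I (deriven_on I i (fun t => Y t w))) ->
  forall t, I t ->
  measurable_fun G (fun w => deriven_on I j (fun t => Y t w) t).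
Proof.
elim: j => [|j IH] dY t It; first exact: mY.
have {}IH := IH (fun w Gw i ij => dY w Gw i (ltnW ij)).
have [y Iy ty] : exists2 y, I y & t != y.
  by have [->|tc] := eqVneq t c; [exists c'|exists c].
have [v vI cv] := cvg_within_punctured itvI It Iy ty.
apply: (@measurable_fun_cvg _ _ _ _ (fun n w =>
    diff_quotient (deriven_on I j (fun t => Y t w)) t (v n))) => [n|w Gw].
  by apply: measurable_funM => //; apply: measurable_funB; exact: IH.
exact: cvg_comp cv (dY w Gw j (ltnSn j) t It).
Qed.

(** The event [E] is that [|X^(k)|] exceeds [a] at a point of a countable dense
set: it is measurable, it lies in the event that the supremum exceeds [a], and off
it continuity extends the bound to all of [I]. *)
Lemma sup_norm_deriven_on_tail (P : probability Omega R) (k m : nat) (a : R) :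
  measurable G -> (forall w, G w -> Ck_on I k (fun t => Y t w)) -> 0 <= a ->
  exists E : set Omega, [/\ measurable E,
    forall w, G w -> ~ E w -> forall t, I t ->
      `|deriven_on I k (fun t => Y t w) t| <= a &
    ((a ^+ m)%:E * P E <=
       \int[P]_w (sup_norm_on I (deriven_on I k (fun t => Y t w)) ^+ m))%E].
Proof.
move=> mG CY a0.
have [D ID dD] := interval_dense_seq itvI Ic.
pose F w := deriven_on I k (fun t => Y t w).
have mF t : I t -> measurable_fun G (fun w => F w t).
  by apply: measurable_deriven_on => w Gw; have [] := CY w Gw.
pose E := \bigcup_n (G `&` [set w | a < `|F w (D n)|]).
have mE : measurable E.
  apply: bigcup_measurable => n _.
  have mFn : measurable_fun G (fun w => `|F w (D n)|).
    by apply: measurableT_comp => //; exact: mF.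
  have := mFn mG _ (measurable_itv `]a, +oo[).
  by rewrite preimage_itvoy.
exists E; split => // [w Gw nEw t It|].
  have [y Iy ty] : exists2 y, I y & t != y.
    by have [->|tc] := eqVneq t c; [exists c'|exists c].
  apply: (continuous_le_dense (f := fun t => `|F w t|) itvI It Iy ty ID dD).
    have [_ cF] := CY w Gw.
    by move=> x; apply: continuous_comp; [exact: cF|exact: norm_continuous].
  move=> n; rewrite leNgt; apply/negP => aF; apply: nEw.
  by exists n.
apply: markov_lower => // [w|w [n _ [_ /= aF]]].
  exact: sup_norm_on_ge0 Ic.
apply: le_trans (sup_norm_on_ge _ (ID n)).
by rewrite lee_fin ltW.
Qed.

End PathDerivatives.

(** * Moments from dyadic tails *)

Section DyadicMoment.
Context {R : realType} {d : measure_display} {T : measurableType d}.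
Variable P : probability T R.

(** The indicator [b i] marks the scales at which the bound on [z] fails.  If
scale [0] does not fail, [c ^+ p] dominates [z ^+ p]; if [n+1] is the first scale
that does not fail, the term of index [n] alone dominates it; if all scales fail, the series diverges because its terms are at least
[1]. *)
Lemma expe_le_dyadic_series (z : \bar R) (c : R) (p : nat) (b : pred nat) :
  (0 <= z)%E -> 1 <= c ->
  (forall i, ~~ b i -> (z <= (c * 2 ^+ i)%:E)%E) ->
  (z ^+ p <= (c ^+ p)%:E +
     \big[+%E/0]_(0 <= i <oo) ((c * 2 ^+ i.+1) ^+ p * (b i)%:R)%:E)%E.
Proof.
move=> z0 c1 zb; have c0 : 0 <= c by rewrite (le_trans ler01).
pose q i := (c * 2 ^+ i.+1) ^+ p.
have q1 i : 1 <= q i by rewrite exprn_ege1 // mulr_ege1 // exprn_ege1 // ler1n.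
have qb0 i : (0 <= (q i * (b i)%:R)%:E)%E.
  by rewrite lee_fin mulr_ge0 // (le_trans ler01 (q1 i)).
have S_ge n : (\sum_(0 <= i < n) (q i * (b i)%:R)%:E <=
    \big[+%E/0]_(0 <= i <oo) (q i * (b i)%:R)%:E)%E.
  by apply: (@nneseries_lim_ge R (fun i => (q i * (b i)%:R)%:E) predT 0%N n).
have [[i bi]|allb] := pselect (exists i, ~~ b i); last first.
  suff -> : (\big[+%E/0]_(0 <= i <oo) (q i * (b i)%:R)%:E = +oo)%E.
    by rewrite addey // leey.
  apply/eqyP => r r0.
  apply: le_trans (S_ge (Num.truncn r).+1).
  rewrite sumEFin lee_fin (le_trans (ltW (truncnS_gt r))) //.
  rewrite -[leLHS](_ : \sum_(0 <= i < (Num.truncn r).+1) 1 = _); last first.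
    by rewrite sumr_const_nat subn0.
  apply: ler_sum => i _.
  have -> : b i by apply/negPn/negP => bi; apply: allb; exists i.
  by rewrite mulr1.
case: (ex_minnP (ex_intro (fun i => ~~ b i) i bi)) => {bi} -[|n] bn minn.
  apply: (@le_trans _ _ (c ^+ p)%:E).
    by rewrite EFin_expe lee_expe // (le_trans (zb _ bn)) // expr0 mulr1.
  by rewrite leeDl //; apply: nneseries_ge0 => n _ _; exact: qb0.
apply: (@le_trans _ _ (q n * (b n)%:R)%:E).
  have -> : b n by apply/negPn/negP => /minn; rewrite ltnn.
  by rewrite mulr1 EFin_expe lee_expe // zb.
apply: (@le_trans _ _ (\sum_(0 <= i < n.+1) (q i * (b i)%:R)%:E)%E).
  by rewrite big_nat_recr //= leeDr // sume_ge0.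
by apply: le_trans (S_ge n.+1) _; rewrite leeDr // lee_fin exprn_ge0.
Qed.

(** Integrating [expe_le_dyadic_series] leaves a geometric series of ratio
[2 ^+ p * rho]. *)
Lemma moment_finite_of_dyadic_tails (Z : T -> \bar R) (E : nat -> set T)
    (c A rho : R) (p : nat) :
  (forall w, 0 <= Z w)%E -> 1 <= c -> 0 <= A -> 0 < rho -> 2 ^+ p * rho < 1 ->
  (forall i, measurable (E i)) ->
  (forall i w, ~ E i w -> Z w <= (c * 2 ^+ i)%:E)%E ->
  (forall i, P (E i) <= (A * rho ^+ i)%:E)%E ->
  (\int[P]_w (Z w ^+ p) < +oo)%E.
Proof.
move=> Z0 c1 A0 rho0 rho1 mE ZE PE.
have c0 : 0 <= c by rewrite (le_trans ler01).
have c2 i : 0 <= (c * 2 ^+ i.+1) ^+ p by rewrite exprn_ge0 // mulr_ge0 // exprn_ge0.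
pose g i w := ((c * 2 ^+ i.+1) ^+ p * \1_(E i) w)%:E.
have g0 i w : (0 <= g i w)%E by rewrite lee_fin mulr_ge0.
have mg i : measurable_fun setT (g i).
  apply/measurable_EFinP; apply: measurable_funM; first exact: measurable_cst.
  exact: measurable_indic.
have ZG w : (Z w ^+ p <= (c ^+ p)%:E + \big[+%E/0]_(0 <= i <oo) g i w)%E.
  rewrite /g; under eq_eseriesr do rewrite indicE.
  apply: expe_le_dyadic_series => // i wE; apply: ZE => Ew.
  by move/negP: wE; apply; exact/mem_set.
apply: le_lt_trans (ge0_le_lower_integral P _ ZG) _.
  by move=> w; exact: expe_ge0.
rewrite ge0_integralD //; last 3 first.
- by move=> w _; rewrite lee_fin exprn_ge0.
- by move=> w _; exact: nneseries_ge0.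
- by apply: ge0_emeasurable_sum => // i w _ _; exact: g0.
rewrite integral_cst //.
rewrite [X in (_ * X)%E](@probability_setT _ _ _ P) mule1 integral_nneseries //.
have Pg i : (\int[P]_w g i w <=
    ((c * 2) ^+ p * A * (2 ^+ p * rho) ^+ i)%:E)%E.
  rewrite /g integral_scaled_indic //.
  apply: (@le_trans _ _ (((c * 2 ^+ i.+1) ^+ p)%:E * (A * rho ^+ i)%:E)%E).
    by apply: lee_pmul; rewrite ?lee_fin // PE.
  rewrite -EFinM lee_fin exprS mulrA !exprMn -!exprM [(i * p)%N]mulnC.
  by rewrite le_eqVlt; apply/orP; left; apply/eqP; ring.
rewrite lte_add_pinfty ?ltry //.
apply: (@le_lt_trans _ _ ((c * 2) ^+ p * A / (1 - 2 ^+ p * rho))%:E); last first.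
  exact: ltry.
apply: lime_le; first by apply: is_cvg_nneseries => i _ _; exact: integral_ge0.
apply: nearW => n.
apply: (@le_trans _ _ (\sum_(0 <= i < n)
    ((c * 2) ^+ p * A * (2 ^+ p * rho) ^+ i)%:E)%E); first exact: lee_sum.
rewrite sumEFin lee_fin; apply: (geometric_le_lim n) => //.
- by rewrite mulr_ge0 // exprn_ge0 // mulr_ge0.
- by rewrite mulr_gt0 // exprn_gt0.
- by rewrite ger0_norm // ltW // mulr_gt0 // exprn_gt0.
Qed.

End DyadicMoment.

(** * The tail of the number of crossings *)

Section LevelCountTail.
Context {R : realType} {d : measure_display} {Omega : measurableType d}.
Variable P : probability Omega R.

Lemma density_ball_le (Y : {RV P >-> R}) (f : R -> R) (C u e : R) :
  is_density Y f -> 0 <= C -> 0 <= e ->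
  (forall x, `|x - u| <= e -> f x <= C) ->
  (P [set w | (`|Y w - u| <= e)%R] <= (C * (e *+ 2))%:E)%E.
Proof.
move=> [mf f0 distY] C0 e0 fC.
pose A := `[u - e, u + e]%classic.
have mA : measurable A by exact: measurable_itv.
have AE x : A x = (`|x - u| <= e) :> Prop.
  by rewrite /A /= in_itv /= ler_distl.
have -> : [set w | `|Y w - u| <= e] = Y @^-1` A.
  by apply/seteqP; split => w /=; rewrite AE.
rewrite -[X in (X <= _)%E]/(distribution P Y A) distY //.
apply: (@le_trans _ _ (\int[lebesgue_measure]_(x in A) C%:E)%E).
  apply: ge0_le_integral => //.
  - by move=> x _; rewrite lee_fin.
  - by apply/measurable_EFinP; exact: measurable_funS mf.
  - by move=> x; rewrite AE lee_fin => /fC.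
rewrite integral_cst //= lebesgue_measure_itv /= lte_fin.
case: ifPn => _; last by rewrite mule0 lee_fin mulr_ge0 // mulrn_wge0.
rewrite -EFinD -EFinM lee_fin ler_wpM2l // mulr2n; lra.
Qed.

(** Off the null set [N], the count can exceed [n k] only if the derivative of order
[k+1] exceeds [a] somewhere or [X] is close to [u] at one of the [n] sampling
points. *)
Lemma level_count_tail (X : R -> {RV P >-> R}) (I : set R) (c c' u : R)
    (k m n : nat) (N : set Omega) (C e0 a h x0 B : R) :
  is_interval I -> I c -> I c' -> c != c' ->
  measurable N -> P N = 0%E ->
  (forall w, ~ N w -> Ck_on I k.+1 (fun t => X t w)) ->
  (\int[P]_w (sup_norm_on I (deriven_on I k.+1 (fun t => X t w)) ^+ m)
    <= B%:E)%E ->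
  (forall t e, I t -> 0 <= e <= e0 ->
    (P [set w | (`|X t w - u| <= e)%R] <= (C * (e *+ 2))%:E)%E) ->
  0 < h -> (forall x, I x -> x0 <= x < x0 + h * n%:R) ->
  0 < a -> a * h ^+ k.+1 <= e0 ->
  exists E, [/\ measurable E,
    forall w, ~ E w -> (level_count X I u w <= (n * k)%:R%:E)%E &
    (P E <= (B / a ^+ m + n%:R * (C * (a * h ^+ k.+1 *+ 2)))%:E)%E].
Proof.
move=> itvI Ic Ic' cc' mN PN0 CkX momB densC h0 gridI a0 ah.
have mX t : I t -> measurable_fun (~` N) (X t).
  by move=> _; exact: measurable_funTS.
have [E1 [mE1 E1le PE1]] := sup_norm_deriven_on_tail itvI Ic Ic' cc' mX P m
  (measurableC mN) CkX (ltW a0).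
(* A sampling point in each cell; in an empty cell the value [c] is a dummy
   that only has to lie in [I], where the density bound holds. *)
pose t j := if pselect (grid_cell I x0 h j !=set0) is left ne
  then projT1 (cid ne) else c.
have cell_t j : grid_cell I x0 h j !=set0 -> grid_cell I x0 h j (t j).
  by move=> ne; rewrite /t; case: pselect => // ne'; case: cid.
have It j : I (t j).
  by rewrite /t; case: pselect => // ne; case: cid => x [].
pose e := a * h ^+ k.+1.
have eP : 0 <= e by rewrite mulr_ge0 ?exprn_ge0 // ltW.
pose S j := [set w | `|X (t j) w - u| <= e].
have mS j : measurable (S j).
  have mXt : measurable_fun setT (fun w => `|X (t j) w - u|).
    by apply: measurableT_comp => //; apply: measurable_funB.
  have := mXt measurableT _ (measurable_itv `]-oo, e]).
  by rewrite setTI preimage_itvNyc.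
have mUS : measurable (\big[setU/set0]_(j < n) S j).
  by apply: bigsetU_measurable.
exists (N `|` E1 `|` \big[setU/set0]_(j < n) S j); split.
- by apply: measurableU => //; exact: measurableU.
- move=> w; rewrite -bigcup_mkord => nE.
  have [nN nE1 nS] : [/\ ~ N w, ~ E1 w & forall j, (j < n)%N -> ~ S j w].
    split; [by move=> Nw; apply: nE; left; left
      |by move=> Ew; apply: nE; left; right|].
    by move=> j jn Sjw; apply: nE; right; exists j.
  apply: (@level_count_le_cells _ I k _ u a h n (fun j => grid_cell I x0 h j)
    (fun j => t j) itvI (CkX _ nN) (E1le w nN nE1)) => //.
  + by move=> j; exact: grid_cell_interval.
  + by move=> j x [].
  + exact: grid_cell_cover.
  + by move=> j x y; exact: grid_cell_diam.
  + by move=> j; exact: cell_t.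
  + by move=> j; rewrite ltNge; apply/negP; exact: nS.
- apply: le_trans (measureU2 _ _ mUS) _; first exact: measurableU.
  rewrite EFinD; apply: leeD.
    apply: le_trans (measureU2 _ mN mE1) _.
    rewrite [X in (X + _)%E]PN0 add0e EFinM.
    rewrite lee_pdivlMr ?exprn_gt0 // muleC.
    exact: le_trans PE1 momB.
  apply: le_trans (Boole_inequality _ _) _; first by move=> i _.
  apply: (@le_trans _ _ (\sum_(j < n) (C * (e *+ 2))%:E)%E).
    by apply: lee_sum => j _; apply: densC => //; rewrite eP.
  by rewrite sumEFin sumr_const card_ord mulr_natl.
Qed.

End LevelCountTail.

(** * Finiteness of the moments *)

(** With [theta = 2^(k/(m+1))], so that the threshold [theta^i] is [n^(k/(m+1))]
up to a constant, the Markov term and the density term decay at the same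
rate [theta^(-m i)]. *)
Lemma dyadic_tail_sum (R : realType) (k m K i : nat) (theta B C h : R) :
  0 < theta -> theta ^+ m.+1 = 2 ^+ k ->
  B / (theta ^+ i) ^+ m +
    (K * 2 ^ i)%:R * (C * (theta ^+ i * (h / 2 ^+ i) ^+ k.+1 *+ 2)) =
  (B + K%:R * C * (h ^+ k.+1 *+ 2)) * (theta ^+ m)^-1 ^+ i.
Proof.
move=> t0 tm; have tn0 : theta != 0 by rewrite gt_eqF.
have two_i : (2 ^+ i : R) != 0 by rewrite expf_neq0 // pnatr_eq0.
rewrite natrM natrX expr_div_n.
have -> : ((2 ^+ i) ^+ k.+1 : R) = 2 ^+ i * (theta ^+ i * (theta ^+ i) ^+ m).
  rewrite exprS; congr (_ * _).
  by rewrite -[RHS]exprS -[LHS]exprM mulnC exprM -tm -!exprM mulnC.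
rewrite exprVn -!exprM [(i * m)%N]mulnC.
by field; rewrite !expf_neq0.
Qed.

Lemma level_count_le1 (R : realType) (d : measure_display)
    (Omega : measurableType d) (X : R -> Omega -> R) (I : set R) (u : R) w :
  (forall x y, I x -> I y -> x = y) -> (level_count X I u w <= 1%:E)%E.
Proof.
move=> I1; apply: (@counting_le R _ 1%N) => -[|x [|y s]] //= /andP[].
rewrite inE negb_or => /andP[/eqP xy _] _ sol; case: xy.
apply: I1; first by have [] := sol x (mem_head _ _).
by have [] := sol y; rewrite ?inE ?eqxx ?orbT.
Qed.

Theorem corollary4p1 (R : realType) (d : measure_display)
  (Omega : measurableType d) (P : probability Omega R)
  (lambda : R) (beta tau : nat -> {RV P >-> R}) (g : R -> R)
  (X : R -> {RV P >-> R}) (I : set R) (u : R) (k m : nat)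
  (hX : shot_noise lambda beta tau g X)
  (hstat : stationary X)
  (hI : is_interval I) (hIb : bounded_set I)
  (hk : (1 <= k)%N) (hm : (1 <= m)%N)
  (hpath : {ae P, forall w, Ck_on I k (fun t => X t w)})
  (hmom : (\int[P]_w (sup_norm_on I (deriven_on I k (fun t => X t w)) ^+ m)
             < +oo)%E)
  (hdens : exists2 C : R, 0 < C &
     exists2 V : set R, nbhs u V &
       forall t, I t -> exists2 f : R -> R, is_density (X t) f &
         forall x, V x -> f x <= C)
  (p : nat) (hp : (1 <= p)%N)
  (hpm : p%:R < m%:R / m.+1%:R * (k%:R - 1) :> R) :
  (\int[P]_w (level_count X I u w ^+ p) < +oo)%E.
Proof.
have cnt0 w : (0 <= level_count X I u w)%E.
  by rewrite /level_count /counting; case: asboolP => // _; rewrite lee_fin.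
(* A one-point interval carries no derivative; the count is then at most 1. *)
have [I1|] := pselect (forall x y, I x -> I y -> x = y).
  apply: le_lt_trans (ge0_le_lower_integral P (g := cst 1%E) _ _) _.
  - by move=> w; rewrite expe_ge0.
  - move=> w; have := lee_expe p (cnt0 w) (level_count_le1 (fun t => X t) u w I1).
    by rewrite -EFin_expe expr1n.
  - by rewrite integral_cst // mul1e [X in (X < _)%E](@probability_setT _ _ _ P) ltry.
move=> /existsNP[c] /existsNP[c'] /not_implyP[Ic] /not_implyP[Ic'] /eqP cc'.
case: k hk hpath hmom hpm => // k _ hpath hmom hpm.
have [N [mN PN0 CkN]] := hpath.
have {}CkN w : ~ N w -> Ck_on I k.+1 (fun t => X t w).
  by move=> Nw; apply: contrapT => /CkN.
pose momB := (\int[P]_w (sup_norm_on I (deriven_on I k.+1 (fun t => X t w)) ^+ m))%E.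
have mom0 : (0 <= momB)%E.
  by apply: integral_ge0 => w _; rewrite expe_ge0 // (sup_norm_on_ge0 _ Ic).
pose B := fine momB.
have B0 : 0 <= B by exact: fine_ge0.
have momE : momB = B%:E by rewrite fineK // ge0_fin_numE.
have [C C0 [V /nbhs_ballP[delta /= delta0 Vu] densV]] := hdens.
pose e0 := delta / 2.
have e00 : 0 < e0 by rewrite divr_gt0.
have densC t e : I t -> 0 <= e <= e0 ->
    (P [set w | (`|X t w - u| <= e)%R] <= (C * (e *+ 2))%:E)%E.
  move=> It /andP[e_ge0 ee0]; have [f df fC] := densV t It.
  apply: density_ball_le df (ltW C0) e_ge0 _ => x xu; apply: fC; apply: Vu.
  rewrite /ball /= distrC (le_lt_trans xu) // (le_lt_trans ee0) //.
  by rewrite /e0 ltr_pdivrMr // mulr_natr mulr2n ltrDl.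
have [M [_ /(_ (M + 1)) IM]] := hIb.
have {}IM x : I x -> `|x| <= M + 1 by apply: IM; rewrite ltrDl.
have M0 : 0 <= M + 1 by exact: le_trans (IM c Ic).
pose L := (M + 1) *+ 2 + 1.
have L0 : 0 < L by rewrite ltr_wpDl // mulrn_wge0.
(* The summand [L] makes [h <= 1], so that [h ^+ k.+1 <= h], and [L / e0] makes
   [h <= e0]. *)
pose K := (Num.truncn (L + L / e0)).+1.
have KL : L + L / e0 < K%:R by exact: truncnS_gt.
have Le0 : 0 < L / e0 by rewrite divr_gt0.
have K0 : (0 : R) < K%:R by rewrite ltr0n.
pose h := L / K%:R.
have h0 : 0 < h by rewrite divr_gt0.
have h1 : h <= 1.
  by rewrite ler_pdivrMr // mul1r (le_trans _ (ltW KL)) // lerDl ltW.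
have he0 : h <= e0.
  rewrite ler_pdivrMr // mulrC -ler_pdivrMr //.
  by rewrite (le_trans _ (ltW KL)) // lerDr ltW.
(* The scale [n = K 2^i] uses the threshold [a = theta^i]. *)
pose theta : R := 2 `^ (k%:R / m.+1%:R).
have theta0 : 0 < theta by rewrite powR_gt0.
have theta_pow : theta ^+ m.+1 = 2 ^+ k.
  by rewrite -powR_mulrn ?ltW // -powRrM divfK ?pnatr_eq0 // powR_mulrn.
have theta1 : 1 <= theta.
  by rewrite -(@powRr0 R 2) ler_powR ?ler1n // divr_ge0.
have theta_le : theta <= 2 ^+ k.+1.
  apply: (@le_trans _ _ (2 ^+ k)); last by rewrite ler_weXn2l // ler1n.
  by rewrite -theta_pow exprS ler_peMr ?exprn_ege1 // ltW.
(* This is the bound on [p]: after raising to the power [m.+1], which turns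
   [theta] into [2 ^+ k], it compares two exponents of [2]. *)
have rho_lt1 : 2 ^+ p * (theta ^+ m)^-1 < 1.
  rewrite ltr_pdivrMr ?exprn_gt0 // mul1r.
  rewrite -(@ltr_pXn2r _ m.+1) ?nnegrE ?exprn_ge0 // ?ltW //.
  rewrite [ltRHS]exprAC theta_pow -!exprM ltr_eXn2l ?ltr1n //.
  rewrite -(ltr_nat R) !natrM -ltr_pdivlMr ?ltr0n //.
  by move: hpm; rewrite -[in k.+1%:R]addn1 natrD addrK mulrC mulrA.
have /boolp.choice[E HE] : forall i, exists E : set Omega,
  [/\ measurable E,
    forall w, ~ E w -> (level_count X I u w <= (K * 2 ^ i * k)%:R%:E)%E &
    (P E <= (B / (theta ^+ i) ^+ m + (K * 2 ^ i)%:R *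
       (C * (theta ^+ i * (h / 2 ^+ i) ^+ k.+1 *+ 2)))%:E)%E].
  move=> i.
  have two_i : (0 : R) < 2 ^+ i by rewrite exprn_gt0.
  apply: (level_count_tail (x0 := - (M + 1)) hI Ic Ic' cc' mN PN0 CkN _ densC).
  - by rewrite -momE.
  - by rewrite divr_gt0.
  - move=> x /IM; rewrite ler_norml => /andP[-> xM].
    rewrite natrM natrX /h.
    have -> : L / K%:R / 2 ^+ i * (K%:R * 2 ^+ i) = L.
      by field; rewrite !gt_eqF.
    by rewrite /L /=; lra.
  - by rewrite exprn_gt0.
  - rewrite expr_div_n mulrA mulrAC -exprM mulnC exprM -expr_div_n.
    apply: (@le_trans _ _ (1 * h ^+ k.+1)).
      apply: ler_wpM2r; first by rewrite exprn_ge0 // ltW.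
      apply: exprn_ile1; first by rewrite divr_ge0 ?exprn_ge0 // ltW.
      by rewrite ler_pdivrMr ?exprn_gt0 // mul1r.
    by rewrite mul1r exprS (le_trans _ he0) // ler_piMr ?exprn_ile1 // ltW.
apply: (@moment_finite_of_dyadic_tails _ _ _ P _ E (K * k.+1)%:R
  (B + K%:R * C * (h ^+ k.+1 *+ 2)) (theta ^+ m)^-1) => //.
- by rewrite ler1n.
- by rewrite addr_ge0 // !mulr_ge0 ?mulrn_wge0 ?exprn_ge0 // ltW.
- by rewrite invr_gt0 exprn_gt0.
- by move=> i; have [] := HE i.
- move=> i w; have [_ /(_ w) Zle _] := HE i => /Zle /le_trans; apply.
  rewrite lee_fin -natrX -natrM ler_nat mulnAC.
  by rewrite !leq_mul.
- by move=> i; have [_ _] := HE i; rewrite dyadic_tail_sum.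
Qed.
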